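(* Let $B$ be a Ferrers board with $l$ columns, each of height at most $m$, and let $B\cup m$ denote the Ferrers board obtained by adding an $(l+1)$-st column of height $m$ to $B$. Then $r_k(a,b;q,p;B)=0$ for $k<0$ or $k>l$; $r_0(a,b;q,p;B)=1$ if $l=0$ (empty board); and for every integer $k$, $$r_k(a,b;q,p;B\cup m)=W_{aq^{2(l-m)},bq^{l-m};q,p}(m-k)\,r_k(a,b;q,p;B)+[m-k+1]_{aq^{2(l-m)},bq^{l-m};q,p}\,r_{k-1}(a,b;q,p;B).$$
   Context: Theta functions: for $x\neq 0$ and $|p|<1$, $\theta(x;p)=\prod_{j\ge0}(1-p^jx)(1-p^{j+1}/x)$, $\theta(x_1,\dots,x_m;p)=\prod_l\theta(x_l;p)$. For nonzero complex $a,b,q$ (generic) and complex $k,z$ define $w_{a,b;q,p}(k)=\frac{\theta(aq^{2k+1},bq^{k},aq^{k-2}/b;p)}{\theta(aq^{2k-1},bq^{k+2},aq^{k}/b;p)}\,q$, the big weight $W_{a,b;q,p}(k)=\frac{\theta(aq^{1+2k},bq,bq^2,aq^{-1}/b,a/b;p)}{\theta(aq,bq^{k+1},bq^{k+2},aq^{k-1}/b,aq^{k}/b;p)}\,q^k$, and $[z]_{a,b;q,p}=\frac{\theta(q^z,aq^z,bq^2,a/b;p)}{\theta(q,aq,bq^{z+1},aq^{z-1}/b;p)}$; subscripts like $W_{aq^{2s},bq^s;q,p}$ mean $(a,b)$ replaced by $(aq^{2s},bq^s)$. Cells $(i,j)$: column $i$, row $j$. A Ferrers board is $B(b_1,\dots,b_n)=\{(i,j):1\le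 i\le n,1\le j\le b_i\}$ with $0\le b_1\le\dots\le b_n$. $\mathcal N_k(B)$: placements of $k$ nonattacking rooks. Each rook cancels the cells strictly to its right in its row and strictly below it in its column; $U_B(P)$: cells neither cancelled nor occupied; $r_{(i,j)}(P)$: number of rooks of $P$ in cells $(i',j')$ with $i'<i$, $j'>j$. Elliptic rook number: $r_k(a,b;q,p;B)=\sum_{P\in\mathcal N_k(B)}\prod_{(i,j)\in U_B(P)}w_{a,b;q,p}(i-j-r_{(i,j)}(P))$. *)

(* Defs.v *)
From HB Require Import structures.
From mathcomp Require Import all_boot all_order all_algebra finmap.
From mathcomp Require Import complex.
From mathcomp Require Import all_classical all_reals topology normedtype sequences.

Set Implicit Arguments.
Unset Strict Implicit.
Unset Printing Implicit Defensive.

Import Order.TTheory GRing.Theory Num.Theory.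
Import numFieldNormedType.Exports.

Local Open Scope ring_scope.
Local Open Scope complex_scope.
Local Open Scope fset_scope.
Local Open Scope classical_set_scope.

(* The topology of R[i] given by its modulus. *)
HB.instance Definition _ (R : realType) :=
  NormedModule.copy R[i] ((R[i] : numFieldType)^o).

Section Theta.
Variable R : realType.
Implicit Types a b q p x : R[i].

Definition theta x p : R[i] :=
  limn (fun n : nat =>
    \prod_(0 <= j < n) ((1 - p ^+ j * x) * (1 - p ^+ j.+1 / x))).

Definition thetas (xs : seq R[i]) p : R[i] := \prod_(x <- xs) theta x p.

(* The arguments k and z are integers, so that powers of q do not depend on a
   choice of logarithm of q. *)
Definition small_weight a b q p (k : int) : R[i] :=
  thetas [:: a * q ^ (2 * k + 1); b * q ^ k; a * q ^ (k - 2) / b] p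
  / thetas [:: a * q ^ (2 * k - 1); b * q ^ (k + 2); a * q ^ k / b] p * q.

Definition big_weight a b q p (k : int) : R[i] :=
  thetas [:: a * q ^ (1 + 2 * k); b * q; b * q ^+ 2; a * q^-1 / b; a / b] p
  / thetas [:: a * q; b * q ^ (k + 1); b * q ^ (k + 2);
               a * q ^ (k - 1) / b; a * q ^ k / b] p * q ^ k.

Definition elliptic_number a b q p (z : int) : R[i] :=
  thetas [:: q ^ z; a * q ^ z; b * q ^+ 2; a / b] p
  / thetas [:: q; a * q; b * q ^ (z + 1); a * q ^ (z - 1) / b] p.

(* Genericity: no theta function occurring in a denominator above vanishes, for
   any integer argument and any shift (a q^(2s), b q^s) of the parameters with
   s an integer.  Only odd powers of q accompany a alone. *)
Definition generic a b q p : Prop :=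
  [/\ a != 0, b != 0, q != 0, theta q p != 0 &
      forall n : int,
        [/\ theta (a * q ^ (2 * n + 1)) p != 0,
            theta (b * q ^ n) p != 0 &
            theta (a * q ^ n / b) p != 0]].

End Theta.

(* Cells are pairs (column, row), both counted from 1, and rows are counted
   upwards, so "below" means a smaller second coordinate.  The list h holds the
   column heights b_1, ..., b_n; board h is a Ferrers board when h is
   nondecreasing. *)
Definition board (h : seq nat) : {fset nat * nat} :=
  [fset ((i, j) : nat * nat) | i in iota 1 (size h),
                               j in iota 1 (nth 0%N h i.-1)].

Definition nonattacking (P : {fset nat * nat}) : bool :=
  [forall c : P, forall d : P,
    (c != d) ==> ((val c).1 != (val d).1) && ((val c).2 != (val d).2)].

Definition placements (k : int) (B : {fset nat * nat}) :
    {fset {fset nat * nat}} :=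
  [fset P in fpowerset B | nonattacking P && (Posz #|` P| == k)].

Definition cancels (r c : nat * nat) : bool :=
  ((r.2 == c.2) && (r.1 < c.1)%N) || ((r.1 == c.1) && (c.2 < r.2)%N).

Definition uncancelled (B P : {fset nat * nat}) : {fset nat * nat} :=
  [fset c in B | (c \notin P) && ~~ [exists r : P, cancels (val r) c]].

(* r_(i,j)(P) for c = (i, j) *)
Definition rooks_nw (P : {fset nat * nat}) (c : nat * nat) : nat :=
  #|` [fset r in P | (r.1 < c.1)%N && (c.2 < r.2)%N] |.

(* The index k is an integer: no placement has negative size, so the sum is
   then empty. *)
Definition rook_number (R : realType) (k : int) (a b q p : R[i])
    (B : {fset nat * nat}) : R[i] :=
  \sum_(P <- placements k B) \prod_(c <- uncancelled B P)
    small_weight a b q p (c.1%:Z - c.2%:Z - (rooks_nw P c)%:Z).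

(* Main.v *)
Require Import Defs.
From mathcomp Require Import all_boot all_order all_algebra finmap.
From mathcomp Require Import complex.
From mathcomp Require Import all_classical all_reals topology normedtype.
From mathcomp Require Import sequences exp.
From mathcomp Require Import ring lra zify.

(* Split the placements on B u m according to whether the last column holds a
   rook.  Given the k rooks in B, the m - k free cells of the last column carry,
   read from the top, the weights w(s + 1), w(s + 2), ... with s = l - m: each
   row skipped because of a rook above is compensated by r_(i,j).  Without a rook
   in the last column the product of all of them telescopes to the big weight.
   With a rook in it only the cells above that rook survive, which yields a sum
   of big weights W(0) + ... + W(m - k), and this is an elliptic number because
   [n + 1] = [n] + W(n).

   That identity is an instance of the Weierstrass addition formula.  To prove
   it, expand theta(xy) theta(x/y) by the Jacobi triple product (obtained from
   its finite form by dominated convergence) and regroup the terms x^(m+n)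
   y^(m-n) by the parity of m + n: up to a constant, theta(xy) theta(x/y) is
   x (f(x) g(y) - g(x) f(y)) for two functions f, g, so the addition formula is
   a Pluecker relation. *)

Set Implicit Arguments.
Unset Strict Implicit.
Unset Printing Implicit Defensive.

Import Order.TTheory GRing.Theory Num.Theory.
Import numFieldNormedType.Exports.
Local Open Scope ring_scope.
Local Open Scope complex_scope.

(** * Limits of sequences and products of complex numbers *)

Section ComplexLimits.
Local Open Scope classical_set_scope.
Local Open Scope ring_scope.
Variable R : realType.
Implicit Types (u : nat -> R) (z : nat -> R[i]).

Lemma normc_real (x : R) : `|x%:C| = `|x|%:C :> R[i].
Proof. by rewrite normc_def /= expr0n /= addr0 sqrtr_sqr. Qed.

Lemma norm_complexE (z : R[i]) : `|z| = (complex.Re `|z|)%:C.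
Proof. by rewrite normc_def. Qed.

Lemma cvg_real_complex u (l : R) :
  u @ \oo --> l -> (fun n => (u n)%:C) @ \oo --> (l%:C : R[i]).
Proof.
move=> ul; apply/cvgrPdist_lt => -[e e'] /=; rewrite ltcE /= => /andP[/eqP-> e0].
have /cvgrPdist_lt /(_ _ e0) := ul; apply: filterS => n.
by rewrite -rmorphB /= normc_real -ltcR.
Qed.

Lemma cvgn_complex z : cvgn (fun n => complex.Re (z n)) ->
  cvgn (fun n => complex.Im (z n)) -> cvgn z.
Proof.
move=> /cvg_ex[/= x zx] /cvg_ex[/= y zy].
apply/cvg_ex; exists (x%:C + 'i%C * y%:C).
have -> : z = fun n => (complex.Re (z n))%:C + 'i%C * (complex.Im (z n))%:C.
  by apply/funext => n; rewrite -complexE.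
apply: cvgD; first exact: cvg_real_complex.
by apply: cvgM; [exact: cvg_cst | exact: cvg_real_complex].
Qed.

Lemma cvgn_geometric_step u (c r : R) : 0 <= r < 1 ->
  (forall n, `|u n.+1 - u n| <= c * r ^+ n) -> cvgn u.
Proof.
move=> /andP[r0 r1] uS.
have -> : u = fun n => u 0%N + series (telescope u) n.
  by apply/funext => n; exact: eq_sum_telescope.
apply: is_cvgD; first exact: is_cvg_cst.
apply: normed_cvg; apply: (@series_le_cvg _ _ (geometric c r)) => //.
- by move=> n; exact: normr_ge0.
- by move=> n; apply: le_trans (normr_ge0 _) (uS n).
- by apply: is_cvg_geometric_series; rewrite ger0_norm.
Qed.

(** The real and imaginary parts of a step are bounded by its modulus, so the real criterion applies
    to each. *)
Lemma cvgn_geometric_stepc z (c r : R) : 0 <= r < 1 ->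
  (forall n, `|z n.+1 - z n| <= (c * r ^+ n)%:C) -> cvgn z.
Proof.
move=> r01 zS; apply: cvgn_complex; apply: (cvgn_geometric_step (c := c) r01) => n.
- rewrite -lecR; apply: le_trans (zS n); apply: le_trans (normc_ge_Re _).
  by rewrite raddfB.
- rewrite -lecR; apply: le_trans (zS n).
  (* The imaginary part of z is minus the real part of iz, and |iz| = |z|. *)
  apply: (@le_trans _ _ `|complex.Re ('i%C * (z n.+1 - z n))|%:C).
    by case: (z n.+1) => a b; case: (z n) => a' b' /=; rewrite mul0r mul1r sub0r normrN.
  apply: le_trans (normc_ge_Re _) _.
  have i1 : `|'i%C| = 1 :> R[i] by rewrite normc_def /= expr0n /= expr1n add0r sqrtr1.
  by rewrite normrM i1 mul1r.
Qed.

(** From 1 + x <= e^x in each factor and the sum of a geometric series. *)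
Lemma prod_geometric_le (c r : R) n : 0 <= c -> 0 <= r < 1 ->
  \prod_(0 <= j < n) (1 + c * r ^+ j) <= expR (c / (1 - r)).
Proof.
move=> c0 /andP[r0 r1].
have r1' : 0 < 1 - r by rewrite subr_gt0.
apply: (@le_trans _ _ (expR (c * \sum_(0 <= j < n) r ^+ j))).
  rewrite mulr_sumr expR_sum; apply: ler_prod => j _.
  by rewrite expR_ge1Dx andbT addr_ge0 // mulr_ge0 // exprn_ge0.
rewrite ler_expR ler_wpM2l //.
have -> : \sum_(0 <= j < n) r ^+ j = (1 - r ^+ n) / (1 - r).
  elim: n => [|n IH]; first by rewrite big_geq // expr0 subrr mul0r.
  by rewrite big_nat_recr //= IH exprS; field; rewrite gt_eqF.
by rewrite ler_pdivrMr // mulVf ?gt_eqF // gerBl exprn_ge0.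
Qed.

Lemma norm_prod_le (w : nat -> R[i]) (c r : R) n : 0 <= c -> 0 <= r < 1 ->
  (forall j, `|w j| <= (c * r ^+ j)%:C) ->
  `|\prod_(0 <= j < n) (1 + w j)| <= (expR (c / (1 - r)))%:C.
Proof.
move=> c0 r01 wle.
apply: (@le_trans _ _ (\prod_(0 <= j < n) (1 + c * r ^+ j))%:C).
  rewrite normr_prod rmorph_prod; apply: ler_prod => j _; rewrite normr_ge0 /=.
  by rewrite (le_trans (ler_normD _ _)) // rmorphD /= normr1 lerD2l.
by rewrite lecR prod_geometric_le.
Qed.

(** Consecutive partial products differ by the partial product times [w n]; the partial products are
    uniformly bounded, so the steps decay geometrically. *)
Lemma cvgn_prod (w : nat -> R[i]) (c r : R) : 0 <= c -> 0 <= r < 1 ->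
  (forall j, `|w j| <= (c * r ^+ j)%:C) ->
  cvgn (fun n => \prod_(0 <= j < n) (1 + w j)).
Proof.
move=> c0 r01 wle.
apply: (@cvgn_geometric_stepc _ (expR (c / (1 - r)) * c) r r01) => n.
rewrite big_nat_recr //= mulrDr mulr1 addrC addKr normrM -mulrA rmorphM.
by rewrite ler_pM // norm_prod_le.
Qed.

End ComplexLimits.

(** * Finite Pochhammer and theta products *)

Section Pochhammer.
Variable F : fieldType.
Implicit Types p x : F.

Definition poch p n : F := \prod_(0 <= j < n) (1 - p ^+ j.+1).

Lemma poch0 p : poch p 0 = 1. Proof. by rewrite /poch big_geq. Qed.

Lemma pochS p n : poch p n.+1 = poch p n * (1 - p ^+ n.+1).
Proof. by rewrite /poch big_nat_recr. Qed.

Definition theta_prod p x n : F :=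
  \prod_(0 <= j < n) ((1 - p ^+ j * x) * (1 - p ^+ j.+1 / x)).

End Pochhammer.

(** * Limits and bounds of Pochhammer and theta products for |p| < 1 *)

Section PochhammerLimits.
Local Open Scope classical_set_scope.
Local Open Scope ring_scope.
Variables (R : realType) (p : R[i]).
Hypothesis p1 : `|p| < 1.

Lemma normc_lt1 : exists2 r : R, `|p| = r%:C & 0 <= r < 1.
Proof.
exists (complex.Re `|p|); first exact: norm_complexE.
by rewrite -ler0c -ltcR -norm_complexE normr_ge0.
Qed.

Lemma subr1Xn_neq0 n : 1 - p ^+ n.+1 != 0.
Proof.
rewrite subr_eq0 eq_sym; apply/eqP => pn.
have : `|p| ^+ n.+1 < 1 by rewrite exprn_ilt1.
by rewrite -normrX pn normr1 ltxx.
Qed.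

Lemma poch_neq0 n : poch p n != 0.
Proof.
elim: n => [|n IH]; first by rewrite poch0 oner_neq0.
by rewrite pochS mulf_neq0 // subr1Xn_neq0.
Qed.

(** Since 1/(1 - t) = 1 + t/(1 - t), these bounds put both [poch p n] and its inverse in the form of
    a product of factors 1 + w_j with geometrically small w_j. Here c = 1/(1 - r). *)
Lemma poch_factor : exists2 c : R, 0 <= c & exists2 r : R, 0 <= r < 1 &
  (forall j, `|- p ^+ j.+1| <= (c * r ^+ j)%:C) /\
  (forall j, `|p ^+ j.+1 / (1 - p ^+ j.+1)| <= (c * r ^+ j)%:C).
Proof.
have [r pr r01] := normc_lt1; have /andP[r0 r1] := r01.
have r1' : 0 < 1 - r by rewrite subr_gt0.
have pS j : `|p ^+ j.+1| <= (r ^+ j)%:C.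
  by rewrite normrX pr rmorphXn /= exprS ler_piMl ?exprn_ge0 ?ler0c // -[1]/(1%:C) lecR ltW.
exists (1 - r)^-1; first by rewrite invr_ge0 ltW.
exists r => //; split=> j.
  rewrite normrN; apply: le_trans (pS j) _.
  by rewrite lecR ler_peMl ?exprn_ge0 // invf_ge1 // gerBl.
rewrite normrM mulrC rmorphM /= ler_pM //.
rewrite normfV fmorphV /= lef_pV2 ?posrE ?normr_gt0 ?subr1Xn_neq0 //; last first.
  by rewrite -[0]/(0%:C) ltcR.
rewrite rmorphB /= (le_trans _ (lerB_dist _ _)) // normr1 lerB // normrX pr.
by rewrite exprS ler_piMr ?ler0c // -rmorphXn /= -[1]/(1%:C) lecR exprn_ile1 // ltW.
Qed.

(** The inverse products converge as well, and the product of the two limits is 1; hence l is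
    nonzero. *)
Lemma poch_cvg : exists2 l : R[i], l != 0 & poch p @ \oo --> l.
Proof.
have [c c0 [r r01 [H1 H2]]] := poch_factor.
have /cvg_ex[/= l pl] := cvgn_prod c0 r01 H1.
have /cvg_ex[/= l' pl'] := cvgn_prod c0 r01 H2.
exists l; last exact: pl.
apply/eqP => l0.
have : (fun n => \prod_(0 <= j < n) (1 + - p ^+ j.+1) *
   \prod_(0 <= j < n) (1 + p ^+ j.+1 / (1 - p ^+ j.+1))) @ \oo --> l * l'.
  exact: cvgM pl pl'.
have -> : (fun n => \prod_(0 <= j < n) (1 + - p ^+ j.+1) *
   \prod_(0 <= j < n) (1 + p ^+ j.+1 / (1 - p ^+ j.+1))) = fun=> 1.
  apply/funext => n; rewrite -big_split big1 //= => j _.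
  by field; exact: subr1Xn_neq0.
rewrite l0 mul0r => H.
have : limn (fun=> 1 : R[i]) = 0 by exact/cvg_lim.
by rewrite lim_cst // => /eqP; rewrite oner_eq0.
Qed.

Lemma poch_bounded : exists2 C : R, 0 <= C &
  forall n, `|poch p n| <= C%:C /\ `|(poch p n)^-1| <= C%:C.
Proof.
have [c c0 [r r01 [H1 H2]]] := poch_factor.
exists (expR (c / (1 - r))) => [|n]; first exact: expR_ge0.
split; first exact: norm_prod_le.
have -> : (poch p n)^-1 = \prod_(0 <= j < n) (1 + p ^+ j.+1 / (1 - p ^+ j.+1)).
  apply: (mulfI (poch_neq0 n)); rewrite mulfV ?poch_neq0 // -big_split big1 //=.
  by move=> j _; field; exact: subr1Xn_neq0.
exact: norm_prod_le.
Qed.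

(** [theta] is a [limn], meaningful only once convergence is known. The j-th factor equals 1 + p^j
    (-x - p/x + p^(j+1)), a geometrically small perturbation of 1. *)
Lemma theta_cvg (x : R[i]) : x != 0 -> theta_prod p x @ \oo --> theta x p.
Proof.
move=> x0; have [r pr r01] := normc_lt1; have /andP[r0 r1] := r01.
suff cv : cvgn (theta_prod p x) by exact: cv.
have -> : theta_prod p x =
    fun n => \prod_(0 <= j < n) (1 + (p ^+ j * (- x + - (p / x) + p ^+ j.+1))).
  by apply/funext => n; apply: eq_bigr => j _; rewrite exprS; field.
apply: (@cvgn_prod _ _ (complex.Re `|x| + complex.Re `|p / x| + 1) r) => //.
  by rewrite !addr_ge0 // -ler0c -norm_complexE.
move=> j; rewrite normrM normrX pr mulrC rmorphM rmorphXn !rmorphD /=.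
rewrite -!norm_complexE ler_wpM2r ?exprn_ge0 ?ler0c //.
apply: le_trans (ler_normD _ _) _; apply: lerD.
  by apply: le_trans (ler_normD _ _) _; rewrite !normrN.
by rewrite normrX exprn_ile1 // ltW.
Qed.

End PochhammerLimits.

(** * The finite Jacobi triple product *)

(** The exponent k(k - 1)/2 as a natural number, negative k included: for k = -(n + 1) it is (n +
    1)(n + 2)/2. *)
Definition tri (k : int) : nat :=
  match k with Posz n => 'C(n, 2) | Negz n => 'C(n.+2, 2) end.

Lemma triE k : (tri k)%:Z * 2 = k * (k - 1).
Proof.
have H n : ('C(n, 2))%:Z * 2 = n%:Z * (n%:Z - 1).
  elim: n => [|n IH]; first by rewrite bin0n mul0r.
  by rewrite binS bin1 PoszD mulrDl IH; lia.
by case: k => n; rewrite /tri H ?NegzE; lia.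
Qed.

Definition sym_range (N : nat) : seq int :=
  [seq i%:Z - N%:Z | i <- iota 0 N.*2.+1].

Lemma mem_sym_range N k : (k \in sym_range N) = (`|k| <= N)%N.
Proof.
apply/mapP/idP => [[i ] | kN]; first by rewrite mem_iota => ? ->; lia.
by exists (`|(k + N%:Z)%R|)%N; [rewrite mem_iota; lia | lia].
Qed.

Lemma sym_range_uniq N : uniq (sym_range N).
Proof. by rewrite map_inj_uniq ?iota_uniq // => i j; lia. Qed.

Section FiniteTripleProduct.
Variables (F : fieldType) (p : F).
Hypothesis poch_n0 : forall n, poch p n != 0.

(** Gaussian binomial coefficient in base p, extended by 0 above n so that the Pascal rules also
    cover the boundary. *)
Definition qbinom n i : F :=
  if (i <= n)%N then poch p n / (poch p i * poch p (n - i)) else 0.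

Let onesub n : 1 - p ^+ n.+1 != 0.
Proof. by have := poch_n0 n.+1; rewrite pochS mulf_eq0 negb_or => /andP[]. Qed.

Lemma qbinom0 n : qbinom n 0 = 1.
Proof. by rewrite /qbinom subn0 poch0 mul1r divff. Qed.

Lemma qbinom_pascal n i :
  qbinom n.+1 i.+1 = qbinom n i + p ^+ i.+1 * qbinom n i.+1.
Proof.
rewrite /qbinom ltnS; case: (ltngtP i n) => [lt_in|gt_in|->]; last first.
- by rewrite !subnn poch0 !mulr1 !divff // mulr0 addr0.
- by rewrite mulr0 addr0.
have [j ->] : exists j, n = (i + j).+1 by exists (n - i.+1)%N; lia.
have -> : ((i + j).+2 - i.+1 = j.+1)%N by lia.
have -> : ((i + j).+1 - i = j.+1)%N by lia.
have -> : ((i + j).+1 - i.+1 = j)%N by lia.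
rewrite (pochS p (i + j).+1) (pochS p i) (pochS p j).
have -> : p ^+ (i + j).+2 = p ^+ i.+1 * p ^+ j.+1 by rewrite -exprD; congr (_ ^+ _); lia.
by field; rewrite !poch_n0 !onesub.
Qed.

Lemma qbinom_pascal' n i : (i <= n)%N ->
  qbinom n.+1 i.+1 = p ^+ (n - i) * qbinom n i + qbinom n i.+1.
Proof.
move=> le_in; rewrite /qbinom ltnS; case: (ltngtP i n) le_in => // [lt_in|->] _; last first.
  by rewrite !subnn poch0 !mulr1 !divff // mulr1 addr0.
have [j ->] : exists j, n = (i + j).+1 by exists (n - i.+1)%N; lia.
have -> : ((i + j).+2 - i.+1 = j.+1)%N by lia.
have -> : ((i + j).+1 - i = j.+1)%N by lia.
have -> : ((i + j).+1 - i.+1 = j)%N by lia.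
rewrite (pochS p (i + j).+1) (pochS p i) (pochS p j).
have -> : p ^+ (i + j).+2 = p ^+ i.+1 * p ^+ j.+1 by rewrite -exprD; congr (_ ^+ _); lia.
by field; rewrite !poch_n0 !onesub.
Qed.

(** Comparison of coefficients when a polynomial in x is multiplied by u + v x. The condition
    [c n.+1 = 0] makes the recurrence give the top coefficient too. *)
Lemma mul_linear_sum (c c' : nat -> F) (u v x : F) n : c n.+1 = 0 ->
  c' 0%N = u * c 0%N ->
  (forall i, (i <= n)%N -> c' i.+1 = u * c i.+1 + v * c i) ->
  (\sum_(i < n.+1) c i * x ^+ i) * (u + v * x) = \sum_(i < n.+2) c' i * x ^+ i.
Proof.
move=> cn c0 cS; rewrite [RHS]big_ord_recl /= c0 expr0 mulr1.
have -> : \sum_(i < n.+1) c' (bump 0 i) * x ^+ bump 0 i =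
    u * (\sum_(i < n.+1) c (bump 0 i) * x ^+ bump 0 i) +
    v * x * (\sum_(i < n.+1) c i * x ^+ i).
  rewrite !mulr_sumr -big_split; apply: eq_bigr => i _ /=.
  by rewrite /bump /= add1n cS -1?ltnS // exprS; ring.
rewrite addrA -mulrDr.
have -> : c 0%N + \sum_(i < n.+1) c (bump 0 i) * x ^+ bump 0 i =
    \sum_(i < n.+1) c i * x ^+ i.
  transitivity (\sum_(i < n.+2) c i * x ^+ i).
    by rewrite [RHS]big_ord_recl /= expr0 mulr1.
  by rewrite big_ord_recr /= cn mul0r addr0.
by ring.
Qed.

Let coef n b i : F := (-1) ^+ (i + b) * p ^+ tri (i%:Z - b%:Z) * qbinom n i.

(** Induction on a with b = 0, which is the Gaussian binomial theorem, then on b. Each step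
    multiplies by one linear factor; the two forms of the Pascal rule serve the two inductions. *)
Lemma finite_triple_product_poly a b x :
  \prod_(0 <= j < a) (1 - p ^+ j * x) * \prod_(0 <= j < b) (x - p ^+ j.+1) =
  \sum_(i < (a + b).+1)
    (-1) ^+ (i + b) * p ^+ tri (i%:Z - b%:Z) * qbinom (a + b) i * x ^+ i.
Proof.
elim: b => [|b IHb].
  rewrite [X in _ * X]big_geq // mulr1 addn0; elim: a => [|a IHa].
    by rewrite big_geq // big_ord1 /= qbinom0 !mulr1.
  rewrite big_nat_recr //= IHa.
  have -> : 1 - p ^+ a * x = 1 + - p ^+ a * x by rewrite mulNr.
  apply: (@mul_linear_sum (coef a 0) (coef a.+1 0)) => [||i le_ia]; rewrite /coef.
  - by rewrite /qbinom ltnn mulr0.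
  - by rewrite !qbinom0 [RHS]mul1r.
  - rewrite qbinom_pascal' // !addn0 !subr0 exprS.
    have := triE i.+1%:Z; have := triE i%:Z.
    set t := tri i; set t' := tri _ => ht ht'.
    have -> : t' = (t + i)%N by lia.
    have -> : p ^+ a = p ^+ i * p ^+ (a - i) by rewrite -exprD subnKC.
    by rewrite exprD; ring.
rewrite big_nat_recr //= mulrA IHb.
have -> : x - p ^+ b.+1 = - p ^+ b.+1 + 1 * x by rewrite mul1r addrC.
rewrite addnS; apply: (@mul_linear_sum (coef (a + b) b) (coef (a + b).+1 b.+1)) => [||i le_ia];
  rewrite /coef.
- by rewrite /qbinom ltnn mulr0.
- rewrite !qbinom0 !add0n exprS.
  have := triE (0 - b%:Z); have := triE (0 - b.+1%:Z).
  set t := tri _; set t' := tri _ => ht ht'.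
  have -> : t = (t' + b.+1)%N by lia.
  by rewrite exprD; ring.
- rewrite qbinom_pascal.
  have := triE (i.+1%:Z - b%:Z); have := triE (i.+1%:Z - b.+1%:Z).
  have -> : i%:Z - b%:Z = i.+1%:Z - b.+1%:Z by lia.
  set t := tri _; set t' := tri _ => ht ht'.
  have e : p ^+ b.+1 * p ^+ t' = p ^+ t * p ^+ i.+1.
    by rewrite -!exprD; congr (_ ^+ _); lia.
  have -> : (-1) ^+ (i.+1 + b) = - (-1) ^+ (i + b) :> F by rewrite addSn exprS mulN1r.
  have -> : (-1) ^+ (i.+1 + b.+1) = (-1) ^+ (i + b) :> F.
    by rewrite addSn addnS !exprS mulrA mulrNN !mulr1 mul1r.
  by ring: e.
Qed.

(** The Gaussian binomial of 2N over N + k. The absolute values give it a value for every integer k,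
    bounded uniformly in N and k, as dominated convergence asks. *)
Definition triple_coef N (k : int) : F :=
  poch p N.*2 / (poch p `|N%:Z + k| * poch p `|N%:Z - k|).

(** The general term of the Jacobi triple product series. *)
Definition theta_term (x : F) (k : int) : F := p ^+ tri k * (- x) ^ k.

(** The case a = b = N of the polynomial form: division by x^N turns x - p^(j+1) into 1 - p^(j+1)/x
    and recentres the summation index. *)
Lemma finite_triple_product N x : x != 0 ->
  theta_prod p x N = \sum_(k <- sym_range N) triple_coef N k * theta_term x k.
Proof.
move=> x0; rewrite big_map -[iota 0 _]/(index_iota 0 N.*2.+1) big_mkord.
have -> : theta_prod p x N = x ^- N *
    (\prod_(0 <= j < N) (1 - p ^+ j * x) * \prod_(0 <= j < N) (x - p ^+ j.+1)).
  rewrite /theta_prod big_split /= mulrCA; congr (_ * _).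
  elim: N => [|N IH]; first by rewrite !big_geq // expr0 invr1 mulr1.
  rewrite !big_nat_recr //= IH [x ^+ N.+1]exprS; field.
  by rewrite x0 expf_neq0.
rewrite finite_triple_product_poly addnn mulr_sumr; apply: eq_bigr => i _.
rewrite /qbinom -ltnS ltn_ord /triple_coef /theta_term.
have -> : `|(N%:Z + (i%:Z - N%:Z))%R|%N = i by lia.
have -> : `|(N%:Z - (i%:Z - N%:Z))%R|%N = (N.*2 - i)%N by have := ltn_ord i; lia.
have -> : (- x) ^ (i%:Z - N%:Z) = (-1) ^+ (i + N) * x ^+ i * x ^- N.
  rewrite expfzDr ?oppr_eq0 // -exprnN -exprnP !(exprNn x) invfM invr_sign exprD.
  by ring.
by ring.
Qed.

End FiniteTripleProduct.

(** * Dominated convergence of finite sums *)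

Section SumOverSubseq.
Variables (V : nmodType) (I : eqType).

Lemma sum_subset (F : I -> V) (s1 s2 : seq I) : uniq s1 -> uniq s2 ->
  {subset s1 <= s2} ->
  \sum_(i <- s2) F i = \sum_(i <- s1) F i + \sum_(i <- s2 | i \notin s1) F i.
Proof.
move=> u1 u2 s12; rewrite (bigID (mem s1)) /=; congr (_ + _).
rewrite -big_filter; apply: perm_big; apply: uniq_perm => // [|i].
  exact: filter_uniq.
rewrite mem_filter; case: (boolP (i \in s1)) => [/s12 -> //|]; by [].
Qed.

End SumOverSubseq.

Section DominatedSums.
Local Open Scope classical_set_scope.
Local Open Scope ring_scope.
Variables (R : realType) (I : eqType).
Variables (E : nat -> seq I) (g : I -> R) (C : R).
Hypothesis E_uniq : forall N, uniq (E N).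
Hypothesis E_mono : forall M N, (M <= N)%N -> {subset E M <= E N}.
Hypothesis g_ge0 : forall i, 0 <= g i.
Hypothesis g_bounded : forall N, \sum_(i <- E N) g i <= C.

(** Containing [E N] makes [D N] fill the index set; lying inside some [E L] keeps its sums of g
    under the bound C. *)
Definition exhausts (D : nat -> seq I) := forall N,
  [/\ uniq (D N), {subset E N <= D N} & exists L, {subset D N <= E L}].

(** The sums of g over [E N] increase to a limit; M is an index where they are within e of it. As M
    depends on g alone, the estimate is uniform in D and f. *)
Lemma sum_tail_le (e : R) : 0 < e -> exists M, forall (D : seq I) L,
  uniq D -> {subset E M <= D} -> {subset D <= E L} ->
  forall f : I -> R[i], (forall i, `|f i| <= (g i)%:C) ->
  `|\sum_(i <- D) f i - \sum_(i <- E M) f i| <= e%:C.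
Proof.
move=> e0; pose A N := \sum_(i <- E N) g i.
have A_mono : {homo A : M N / (M <= N)%N >-> M <= N}.
  move=> M N MN; rewrite /A (sum_subset g (E_uniq M) (E_uniq N) (E_mono MN)).
  by rewrite lerDl sumr_ge0.
have Acv : cvgn A.
  apply: nondecreasing_is_cvgn => //.
  by exists C => _ [N _ <-]; exact: g_bounded.
have Ale N : A N <= limn A by exact: nondecreasing_cvgn_le.
have /cvgrPdist_lt /(_ _ e0) [M _ HM] : A @ \oo --> limn A by exact: Acv.
exists M => D L uD sMD sDL f fg.
have sML : {subset E M <= E L} by move=> i /sMD /sDL.
rewrite (sum_subset f (E_uniq M) uD sMD) addrC addKr.
apply: le_trans (ler_norm_sum _ _ _) _.
apply: (@le_trans _ _ (\sum_(i <- D | i \notin E M) g i)%:C).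
  by rewrite rmorph_sum; apply: ler_sum => i _; exact: fg.
rewrite lecR.
apply: (@le_trans _ _ (A L - A M)); last first.
  rewrite lerBlDr (le_trans (Ale L)) // -lerBlDr.
  by have := HM M (leqnn M); move=> /ltW; apply: le_trans; exact: ler_norm.
rewrite /A (sum_subset g (E_uniq M) (E_uniq L) sML) addrC addKr.
rewrite -[leLHS]big_filter -[leRHS]big_filter.
rewrite (@sum_subset _ _ g [seq i <- D | i \notin E M] [seq i <- E L | i \notin E M]).
- by rewrite lerDl sumr_ge0.
- exact: filter_uniq.
- by rewrite filter_uniq.
- by move=> i; rewrite !mem_filter => /andP[-> /sDL].
Qed.

(** An e/3 argument: both sums are cut down to a fixed finite [E M], where termwise convergence
    suffices. Letting [D1] and [D2] differ allows a double series to be rearranged. *)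
Lemma dominated_sum_cvg (D1 D2 : nat -> seq I) (f : nat -> I -> R[i]) (h : I -> R[i]) :
  exhausts D1 -> exhausts D2 ->
  (forall N i, `|f N i| <= (g i)%:C) -> (forall i, `|h i| <= (g i)%:C) ->
  (forall i, f ^~ i @ \oo --> h i) ->
  (fun N => \sum_(i <- D1 N) f N i - \sum_(i <- D2 N) h i) @ \oo --> (0 : R[i]).
Proof.
move=> D1E D2E fg hg fh; apply/cvgrPdist_lt => -[e e'] /=.
rewrite ltcE /= => /andP[/eqP-> e0].
have e3 : 0 < e / 3 by rewrite divr_gt0.
have [M HM] := sum_tail_le e3.
have : (fun N => \sum_(i <- E M) f N i) @ \oo --> \sum_(i <- E M) h i.
  by apply: cvg_big => //; exact: add_continuous.
move=> /cvgrPdist_lt /(_ (e / 3)%:C); rewrite ltcR => /(_ e3) [M' _ HM'].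
exists (maxn M M') => // N /=; rewrite geq_max => /andP[MN MN'].
have [uD1 sD1 [L1 sL1]] := D1E N; have [uD2 sD2 [L2 sL2]] := D2E N.
have H1 := HM _ _ uD1 (fun i Hi => sD1 i (E_mono MN Hi)) sL1 _ (fg N).
have H2 := HM _ _ uD2 (fun i Hi => sD2 i (E_mono MN Hi)) sL2 _ hg.
have H3 := HM' N MN'.
rewrite sub0r normrN -[ltRHS]/(e%:C).
set S1 := \sum_(i <- D1 N) _ in H1 *; set S2 := \sum_(i <- D2 N) _ in H2 *.
set T1 := \sum_(i <- E M) f N i in H1 H3; set T2 := \sum_(i <- E M) h i in H2 H3.
have -> : S1 - S2 = (S1 - T1) + ((T1 - T2) + (T2 - S2)) by ring.
have -> : e%:C = (e / 3)%:C + ((e / 3)%:C + (e / 3)%:C) :> R[i].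
  by rewrite -!rmorphD /=; congr (_ %:C); field.
apply: le_lt_trans (ler_normD _ _) _; apply: ler_ltD => //.
apply: le_lt_trans (ler_normD _ _) _; apply: ltr_leD; rewrite distrC //.
Qed.

End DominatedSums.

(** * Summability of the theta series *)

Section ThetaTermBound.
Variable R : realType.

(** Induction splitting off the term n = 0 and the factor j = 0, which replaces y by y r in what
    remains. *)
Lemma sum_tri_le_prod (r y : R) N : 0 <= r -> 0 <= y ->
  \sum_(n < N.+1) r ^+ 'C(n, 2) * y ^+ n <= \prod_(0 <= j < N) (1 + y * r ^+ j).
Proof.
move=> r0; elim: N y => [|N IH] y y0.
  by rewrite big_ord1 big_geq //= bin0n !expr0 mulr1.
rewrite big_ord_recl /= bin0n !expr0 mulr1 big_nat_recl //= expr0 mulr1.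
have -> : \sum_(i < N.+1) r ^+ 'C(bump 0 i, 2) * y ^+ bump 0 i =
    y * \sum_(n < N.+1) r ^+ 'C(n, 2) * (y * r) ^+ n.
  rewrite mulr_sumr; apply: eq_bigr => i _.
  by rewrite /bump /= add1n binS bin1 exprD exprS exprMn; ring.
have {}IH := IH _ (mulr_ge0 y0 r0).
have e : \prod_(0 <= j < N) (1 + y * r * r ^+ j) = \prod_(0 <= i < N) (1 + y * r ^+ i.+1).
  by apply: eq_bigr => i _; rewrite exprS mulrA.
rewrite {}e in IH; rewrite mulrDl mul1r lerD ?ler_wpM2l //.
elim: {IH} N => [|N IH]; first by rewrite big_geq.
rewrite big_nat_recr //= -[leLHS]mulr1 ler_pM // lerDl mulr_ge0 // exprn_ge0 //.
Qed.

(** The terms with k = -(n + 1) are the terms of index n + 1 of the one-sided series with r/y in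
    place of y, so both halves fall under [sum_tri_le_prod]. *)
Lemma sum_theta_bounded (r y : R) : 0 <= r < 1 -> 0 < y ->
  exists C : R, forall N, \sum_(k <- sym_range N) r ^+ tri k * y ^ k <= C.
Proof.
move=> r01 y0; have /andP[r0 r1] := r01.
exists (expR (y / (1 - r)) + expR (r / y / (1 - r))) => N.
have ry : 0 <= r / y by rewrite divr_ge0 // ltW.
rewrite (@perm_big _ _ _ _ _ ([seq Posz n | n <- iota 0 N.+1] ++
   [seq Negz n | n <- iota 0 N])); last first.
  apply: uniq_perm; first exact: sym_range_uniq.
  - rewrite cat_uniq !map_inj_uniq ?iota_uniq //=; last by move=> ? ? [].
      by rewrite andbT; apply/hasPn => _ /mapP[n _ ->]; apply/mapP => -[].
    by move=> ? ? [].
  - move=> k; rewrite mem_sym_range mem_cat; apply/idP/orP => [kN|[] /mapP[n]].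
    + case: k kN => n nN; [left|right]; apply/mapP; exists n => //; rewrite mem_iota; lia.
    + by rewrite mem_iota => ? ->; lia.
    + by rewrite mem_iota => ? ->; lia.
have iotaE n : iota 0 n = index_iota 0 n by rewrite /index_iota subn0.
rewrite big_cat !big_map !iotaE !big_mkord lerD //.
  by apply: le_trans (sum_tri_le_prod N r0 (ltW y0)) _; exact: prod_geometric_le (ltW y0) r01.
apply: le_trans (prod_geometric_le N ry r01); apply: le_trans (sum_tri_le_prod N r0 ry).
rewrite [leRHS]big_ord_recl /= bin0n !expr0 mulr1 -[leLHS]add0r lerD //.
apply: ler_sum => i _; rewrite /bump /= add1n NegzE -exprnN binS bin1 exprD.
by rewrite exprMn exprVn -mulrA.
Qed.

End ThetaTermBound.

(** * The Weierstrass addition formula *)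

Definition square_range N : seq (int * int) :=
  [seq (m, n) | m <- sym_range N, n <- sym_range N].

(* The pairs (m, n) with m + n even, resp. odd, parametrized by s, d so that
   m + n = 2s + 2, m - n = 2d, resp. m + n = 2s + 1, m - n = 2d + 1: over these
   ranges theta_term (x * y) m * theta_term (x / y) n separates into a product
   of a function of (x, s) and a function of (y, d). *)
Definition diamond_even N : seq (int * int) :=
  [seq (s + d + 1, s - d + 1) | s <- sym_range N.+1, d <- sym_range N.+1].

Definition diamond_odd N : seq (int * int) :=
  [seq (s + d + 1, s - d) | s <- sym_range N.+1, d <- sym_range N.+1].

Lemma mem_square_range N m n :
  ((m, n) \in square_range N) = (`|m| <= N)%N && (`|n| <= N)%N.
Proof.
rewrite -!mem_sym_range; apply/allpairsP/andP => [[[? ?] [? ? [-> ->]]] //|[mN nN]].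
by exists (m, n).
Qed.

Lemma square_range_uniq N : uniq (square_range N).
Proof. by apply: allpairs_uniq; rewrite ?sym_range_uniq // => -[? ?] [? ?]. Qed.

Lemma square_range_exhausts :
  @exhausts _ square_range square_range.
Proof. by move=> N; split => //; [exact: square_range_uniq | exists N]. Qed.

Lemma diamond_exhausts :
  @exhausts _ square_range (fun N => diamond_even N ++ diamond_odd N).
Proof.
move=> N; split; first 1 last.
- move=> [m n]. rewrite mem_square_range mem_cat => /andP[mN nN].
  have [[k kP]|[k kP]] : {k | m + n = 2 * k} + {k | m + n = 2 * k + 1}.
    have := divz_eq (m + n) 2; have := modz_ge0 (m + n) (isT : (2 : int) != 0).
    have := ltz_pmod (m + n) (isT : (0 : int) < 2).
    case: (boolP ((m + n) %% 2 == 0)%Z) => [/eqP e | /eqP ne] ? ? ?.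
      by left; exists ((m + n) %/ 2)%Z; lia.
    by right; exists ((m + n) %/ 2)%Z; lia.
  + apply/orP; left; apply/allpairsP; exists (k - 1, m - k).
    by rewrite !mem_sym_range /=; split; [lia | lia | congr (_, _); lia].
  + apply/orP; right; apply/allpairsP; exists (k, m - k - 1).
    by rewrite !mem_sym_range /=; split; [lia | lia | congr (_, _); lia].
(* With |s|, |d| <= N + 1, the coordinate s + d + 1 has absolute value at most 2N + 3. *)
- exists (N.*2 + 3)%N => -[m n]; rewrite mem_cat mem_square_range.
  by case/orP => /allpairsP[[s d] /=]; rewrite !mem_sym_range => -[? ? [-> ->]]; lia.
- rewrite cat_uniq; apply/and3P; split.
  + apply: allpairs_uniq; rewrite ?sym_range_uniq // => -[? ?] [? ?] _ _ /= [? ?].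
    by congr (_, _); lia.
  + apply/hasPn => _ /allpairsP[[s d] /= [_ _ ->]].
    by apply/negP => /allpairsP[[s' d'] /= [_ _ [? ?]]]; lia.
  + apply: allpairs_uniq; rewrite ?sym_range_uniq // => -[? ?] [? ?] _ _ /= [? ?].
    by congr (_, _); lia.
Qed.

Lemma square_range_mono M N : (M <= N)%N ->
  {subset square_range M <= square_range N}.
Proof. by move=> MN [m n]; rewrite !mem_square_range => /andP[? ?]; apply/andP; lia. Qed.

Lemma sum_square_range (V : pzSemiRingType) (u v : int -> V) N :
  \sum_(c <- square_range N) u c.1 * v c.2 =
  (\sum_(k <- sym_range N) u k) * (\sum_(k <- sym_range N) v k).
Proof.
rewrite big_allpairs mulr_suml; apply: eq_bigr => m _.
by rewrite mulr_sumr.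
Qed.

(** * Products of two theta functions as determinants *)

Section ThetaProduct.
Local Open Scope classical_set_scope.
Local Open Scope ring_scope.
Variables (R : realType) (p : R[i]).
Hypothesis p1 : `|p| < 1.
Local Notation C := R[i].

Lemma normc_mul4_le (s t u v : C) (a b c d : R) :
  `|s| <= a%:C -> `|t| <= b%:C -> `|u| <= c%:C -> `|v| <= d%:C ->
  `|(s * t) * (u * v)| <= (a * b * (c * d))%:C.
Proof.
move=> sa tb uc vd; rewrite (normrM (s * t)) (normrM s) (normrM u) !rmorphM.
by apply: ler_pM; rewrite ?mulr_ge0 //; apply: ler_pM.
Qed.

Lemma triple_coef_bounded : exists2 K : R, 0 <= K &
  forall N k, `|triple_coef p N k| <= K%:C.
Proof.
have [K K0 HK] := poch_bounded p1; exists (K * (K * K)); first by rewrite !mulr_ge0.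
move=> N k; rewrite /triple_coef normrM !rmorphM /= invfM normrM.
have [H _] := HK N.*2; have [_ H1] := HK `|(N%:Z + k)%R|%N.
have [_ H2] := HK `|(N%:Z - k)%R|%N.
by do 2?apply: ler_pM => //; rewrite mulr_ge0.
Qed.

(** For fixed k the indices 2N, N + k and N - k all tend to infinity, so the quotient tends to l/(l
    l). *)
Lemma triple_coef_cvg (l : C) : l != 0 -> poch p @ \oo --> l ->
  forall k, (fun N => triple_coef p N k) @ \oo --> l^-1.
Proof.
move=> l0 pl k.
have sub (phi : nat -> nat) : (forall M, exists N0, forall N, (N0 <= N)%N -> (M <= phi N)%N) ->
    (fun N => poch p (phi N)) @ \oo --> l.
  move=> H; apply: (cvg_comp phi (poch p)) pl => A [M _ HA].
  by have [N0 HN0] := H M; exists N0 => // N /= /HN0; exact: HA.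
have -> : l^-1 = l / (l * l) by field.
apply: cvgM; first by apply: sub => M; exists M => N ?; lia.
apply: cvgV; first by rewrite mulf_neq0.
by apply: cvgM; apply: sub => M; exists (M + `|k|)%N => N ?; lia.
Qed.

Lemma theta_term_summable (x : C) : x != 0 -> exists g : int -> R,
  [/\ forall k, `|theta_term p x k| = (g k)%:C, forall k, 0 <= g k &
      exists B, forall N, \sum_(k <- sym_range N) g k <= B].
Proof.
move=> x0; have [r pr r01] := normc_lt1 p1; have /andP[r0 _] := r01.
have y0 : 0 < complex.Re `|x| by rewrite -ltcR -norm_complexE normr_gt0.
exists (fun k => r ^+ tri k * complex.Re `|x| ^ k); split=> [k|k|]; last first.
- exact: sum_theta_bounded.
- by rewrite mulr_ge0 ?exprn_ge0 // exprz_ge0 // ltW.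
have nx : `|- x| = (complex.Re `|x|)%:C by rewrite normrN -norm_complexE.
rewrite /theta_term normrM normrX pr rmorphM rmorphXn /=; congr (_ * _).
case: k => n; rewrite ?NegzE -?exprnN -?exprnP ?normfV normrX nx.
  by rewrite rmorphXn.
by rewrite fmorphV rmorphXn.
Qed.

(** With y = e^(iz), this and [theta_odd] are truncations of Jacobi's theta_3(z) and p^(-1/4)
    theta_2(z) for the nome p. *)
Definition theta_even N (y : C) : C :=
  \sum_(d <- sym_range N) p ^+ `|(d * d)%R|%N * y ^ (2 * d).

Definition theta_odd N (y : C) : C :=
  \sum_(d <- sym_range N) p ^+ `|(d * (d + 1))%R|%N * y ^ (2 * d + 1).

Definition theta_wedge N (x y : C) : C :=
  x * (theta_odd N x * theta_even N y - theta_even N x * theta_odd N y).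

(** On the even diamond the sign is + and the exponent of p is s(s + 1) + d^2; on the odd one they
    are - and s^2 + d(d + 1). So each double sum factors, giving the two terms of the
    determinant. *)
Lemma theta_wedgeE N (x y : C) : x != 0 -> y != 0 ->
  \sum_(c <- diamond_even N ++ diamond_odd N)
    theta_term p (x * y) c.1 * theta_term p (x / y) c.2 = theta_wedge N.+1 x y.
Proof.
move=> x0 y0; rewrite big_cat /= !big_allpairs_dep /=.
have e0 : - (x * y) != 0 by rewrite oppr_eq0 mulf_neq0.
have e1 : - (x / y) != 0 by rewrite oppr_eq0 mulf_neq0 ?invr_eq0.
have term m n : theta_term p (x * y) m * theta_term p (x / y) n =
    (-1) ^ (m + n) * p ^+ (tri m + tri n) * x ^ (m + n) * y ^ (m - n).
  rewrite /theta_term -[- (x * y)]mulN1r -[- (x / y)]mulN1r !expfzMl.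
  rewrite !expfzDr ?oppr_eq0 ?oner_eq0 // exprD exprz_inv.
  move: ((-1) ^ m) ((-1) ^ n) (x ^ m) (x ^ n) (y ^ m) (y ^ - n) (p ^+ tri m) (p ^+ tri n).
  by move=> *; ring.
have sgn (s : int) : (-1) ^ (2 * s) = 1 :> C.
  by rewrite -exprz_exp -exprnP sqrrN expr1n exp1rz.
rewrite /theta_wedge mulrBr; congr (_ + _).
  rewrite /theta_odd mulr_suml mulr_sumr; apply: eq_bigr => s _.
  rewrite /theta_even !mulr_sumr; apply: eq_bigr => d _.
  rewrite term.
  have -> : (tri (s + d + 1)%R + tri (s - d + 1)%R = `|(s * (s + 1))%R| + `|(d * d)%R|)%N.
    have := triE (s + d + 1); have := triE (s - d + 1); nia.
  have -> : s + d + 1 + (s - d + 1) = 2 * s + 1 + 1 by lia.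
  have -> : s + d + 1 - (s - d + 1) = 2 * d by lia.
  have -> : (-1) ^ (2 * s + 1 + 1) = 1 :> C.
    by rewrite -addrA expfzDr ?oppr_eq0 ?oner_eq0 // sgn mul1r -exprnP sqrrN expr1n.
  by rewrite expfzDr // exprD expr1z; ring.
rewrite -mulrN -mulrN /theta_even mulr_suml mulr_sumr; apply: eq_bigr => s _.
rewrite /theta_odd -sumrN !mulr_sumr; apply: eq_bigr => d _.
rewrite term.
have -> : (tri (s + d + 1)%R + tri (s - d)%R = `|(s * s)%R| + `|(d * (d + 1))%R|)%N.
  have := triE (s + d + 1); have := triE (s - d); nia.
have -> : s + d + 1 + (s - d) = 2 * s + 1 by lia.
have -> : s + d + 1 - (s - d) = 2 * d + 1 by lia.
have -> : (-1) ^ (2 * s + 1) = -1 :> C.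
  by rewrite expfzDr ?oppr_eq0 ?oner_eq0 // sgn mul1r expr1z.
by rewrite expfzDr // exprD expr1z; ring.
Qed.

(** The finite triple products give a sum over a square; dominated convergence compares it with the
    sum over the two diamonds with limiting coefficients 1/l, which is [theta_wedge] divided by
    l^2. *)
Lemma theta_mul_cvg (l : C) : l != 0 -> poch p @ \oo --> l ->
  forall x y : C, x != 0 -> y != 0 ->
  (fun N => theta_wedge N.+1 x y) @ \oo --> l ^+ 2 * (theta (x * y) p * theta (x / y) p).
Proof.
move=> l0 pl x y x0 y0.
have X0 : x * y != 0 by rewrite mulf_neq0.
have Y0 : x / y != 0 by rewrite mulf_neq0 ?invr_eq0.
have [K K0 HK] := triple_coef_bounded.
have [gX [gXE gX0 [BX HX]]] := theta_term_summable X0.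
have [gY [gYE gY0 [BY HY]]] := theta_term_summable Y0.
(* One constant that bounds the coefficients and their limit 1/l alike. *)
pose K' := K + complex.Re `|l^-1|.
have l'0 : 0 <= complex.Re `|l^-1| by rewrite -ler0c -norm_complexE.
have K'0 : 0 <= K' by rewrite addr_ge0.
pose f N (c : int * int) := (triple_coef p N c.1 * theta_term p (x * y) c.1) *
  (triple_coef p N c.2 * theta_term p (x / y) c.2).
pose h (c : int * int) := (l^-1 * theta_term p (x * y) c.1) *
  (l^-1 * theta_term p (x / y) c.2).
pose g (c : int * int) := (K' * gX c.1) * (K' * gY c.2).
have bound (u v : C) c : `|u| <= K'%:C -> `|v| <= K'%:C ->
    `|(u * theta_term p (x * y) c.1) * (v * theta_term p (x / y) c.2)| <= (g c)%:C.
  have hX : `|theta_term p (x * y) c.1| <= (gX c.1)%:C by rewrite gXE.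
  have hY : `|theta_term p (x / y) c.2| <= (gY c.2)%:C by rewrite gYE.
  by move=> uK vK; exact: normc_mul4_le uK hX vK hY.
have H : (fun N => \sum_(c <- square_range N) f N c -
    \sum_(c <- diamond_even N ++ diamond_odd N) h c) @ \oo --> (0 : C).
  apply: (@dominated_sum_cvg R _ square_range g (K' * BX * (K' * BY))).
  - exact: square_range_uniq.
  - by move=> M N; exact: square_range_mono.
  - by move=> c; rewrite /g; apply: mulr_ge0; apply: mulr_ge0.
  - move=> N; rewrite /g (sum_square_range (fun k => K' * gX k) (fun k => K' * gY k)).
    rewrite -!mulr_sumr; apply: ler_pM; rewrite ?ler_wpM2l //.
      by apply: mulr_ge0 => //; apply: sumr_ge0.
    by apply: mulr_ge0 => //; apply: sumr_ge0.
  - exact: square_range_exhausts.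
  - exact: diamond_exhausts.
  - move=> N c; apply: bound; apply: le_trans (HK _ _) _; by rewrite lecR lerDl.
  - by move=> c; apply: bound; rewrite norm_complexE lecR /K' lerDr.
  - move=> c; apply: cvgM; apply: cvgM; try exact: cvg_cst; exact: triple_coef_cvg.
have T : (fun N => theta_prod p (x * y) N * theta_prod p (x / y) N) @ \oo -->
    theta (x * y) p * theta (x / y) p.
  by apply: cvgM; exact: theta_cvg.
have -> : (fun N => theta_wedge N.+1 x y) = fun N => l ^+ 2 *
    (theta_prod p (x * y) N * theta_prod p (x / y) N -
     (\sum_(c <- square_range N) f N c -
      \sum_(c <- diamond_even N ++ diamond_odd N) h c)).
  apply/funext => N; rewrite -theta_wedgeE // !finite_triple_product //; try exact: poch_neq0.
  have -> : \sum_(c <- square_range N) f N c =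
     (\sum_(k <- sym_range N) triple_coef p N k * theta_term p (x * y) k) *
     (\sum_(k <- sym_range N) triple_coef p N k * theta_term p (x / y) k).
    exact: (sum_square_range (fun k => triple_coef p N k * theta_term p (x * y) k)
      (fun k => triple_coef p N k * theta_term p (x / y) k)).
  have -> : \sum_(c <- diamond_even N ++ diamond_odd N) h c = l ^- 2 *
     \sum_(c <- diamond_even N ++ diamond_odd N)
        theta_term p (x * y) c.1 * theta_term p (x / y) c.2.
    rewrite mulr_sumr; apply: eq_bigr => c _.
    by rewrite /h mulrACA -invfM -expr2.
  by rewrite subKr mulrA mulfV ?mul1r // expf_neq0.
apply: cvgM; first exact: cvg_cst.
rewrite -[X in _ --> X]subr0; exact: cvgB T H.
Qed.

(** The relation holds exactly between the truncations, hence between their limits, where every term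
    carries the same nonzero factor l^4. *)
Theorem theta_weierstrass (x y u v : C) : x != 0 -> y != 0 -> u != 0 -> v != 0 ->
  theta (x * y) p * theta (x / y) p * (theta (u * v) p * theta (u / v) p) -
  theta (x * v) p * theta (x / v) p * (theta (u * y) p * theta (u / y) p) =
  u / y * (theta (y * v) p * theta (y / v) p * (theta (x * u) p * theta (x / u) p)).
Proof.
move=> x0 y0 u0 v0; have [l l0 pl] := poch_cvg p1.
have H := theta_mul_cvg l0 pl.
pose T a b := theta (a * b) p * theta (a / b) p.
pose w N a b := theta_wedge N.+1 a b.
(* theta_wedge is x times a 2x2 determinant, so this is a Pluecker relation. *)
have pluecker N : w N x y * w N u v - w N x v * w N u y - u / y * (w N y v * w N x u) = 0.
  rewrite /w /theta_wedge.
  move: (theta_odd N.+1 x) (theta_odd N.+1 y) (theta_odd N.+1 u) (theta_odd N.+1 v).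
  move: (theta_even N.+1 x) (theta_even N.+1 y) (theta_even N.+1 u) (theta_even N.+1 v).
  by move=> *; field.
have cv : (fun N => w N x y * w N u v - w N x v * w N u y -
    u / y * (w N y v * w N x u)) @ \oo -->
  l ^+ 2 * T x y * (l ^+ 2 * T u v) - l ^+ 2 * T x v * (l ^+ 2 * T u y) -
  u / y * (l ^+ 2 * T y v * (l ^+ 2 * T x u)).
  apply: cvgB.
    by apply: cvgB; apply: cvgM; exact: H.
  by apply: cvgM; [exact: cvg_cst | apply: cvgM; exact: H].
rewrite (funext pluecker) in cv.
have e0 := cvg_unique (@norm_hausdorff _ _) cv (cvg_cst 0).
rewrite -/(T x y) -/(T u v) -/(T x v) -/(T u y) -/(T y v) -/(T x u).
move: e0; move: (T x y) (T u v) (T x v) (T u y) (T y v) (T x u).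
move=> t1 t2 t3 t4 t5 t6 e0; apply/eqP; rewrite -subr_eq0; apply/eqP.
by apply: (mulfI (expf_neq0 4 l0)); rewrite mulr0 -e0; ring.
Qed.

(** At x = y = u = v = 1 the left side of the addition formula cancels and the right side is
    theta(1)^4. *)
Lemma theta1 : theta 1 p = 0.
Proof.
have := @theta_weierstrass 1 1 1 1 (oner_neq0 _) (oner_neq0 _) (oner_neq0 _) (oner_neq0 _).
rewrite !divr1 !mulr1 subrr mul1r => /esym/eqP; rewrite !mulf_eq0.
by case: eqP.
Qed.

End ThetaProduct.

(** * Elliptic weights and numbers *)

Section Weights.
Variables (R : realType) (q p : R[i]).
Implicit Types a b : R[i].

Lemma shift_powE a b (s j : int) : b != 0 -> q != 0 ->
  a * q ^ (2 * s) * q ^ j / (b * q ^ s) = a * q ^ (s + j) / b.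
Proof.
move=> b0 q0; have -> : 2 * s = s + s by lia.
by rewrite !expfzDr //; field; rewrite b0 expfz_neq0.
Qed.

Lemma shift_generic a b s : generic a b q p ->
  generic (a * q ^ (2 * s)) (b * q ^ s) q p.
Proof.
case=> a0 b0 q0 qp H; split=> // [||n]; rewrite ?mulf_neq0 ?expfz_neq0 //.
have [H1 H2 H3] := H (n + s); split.
- rewrite -mulrA -expfzDr //.
  by have -> : 2 * s + (2 * n + 1) = 2 * (n + s) + 1 by lia.
- by rewrite -mulrA -expfzDr // (addrC s).
- by rewrite shift_powE // (addrC s).
Qed.

(** Shifting the parameters translates the argument; this is the source of the subscripts in the
    recursion. *)
Lemma small_weight_shift a b (s t : int) : b != 0 -> q != 0 ->
  small_weight (a * q ^ (2 * s)) (b * q ^ s) q p t = small_weight a b q p (s + t).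
Proof.
move=> b0 q0; rewrite /small_weight !shift_powE // -!mulrA -!expfzDr // !mulrA.
have -> : 2 * s + (2 * t + 1) = 2 * (s + t) + 1 by lia.
have -> : 2 * s + (2 * t - 1) = 2 * (s + t) - 1 by lia.
by rewrite !addrA.
Qed.

Variables a b : R[i].
Hypothesis ab_generic : generic a b q p.

(** Apart from theta(q), all denominators are products of these values, nonzero by genericity, so
    the identities between weights reduce to [field]. *)
Let TA (k : int) := theta (a * q ^ (2 * k + 1)) p.
Let TB (k : int) := theta (b * q ^ k) p.
Let TC (k : int) := theta (a * q ^ k / b) p.

Let a0 : a != 0. Proof. by case: ab_generic. Qed.
Let b0 : b != 0. Proof. by case: ab_generic. Qed.
Let q0 : q != 0. Proof. by case: ab_generic. Qed.
Let tq0 : theta q p != 0. Proof. by case: ab_generic. Qed.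
Let TA0 k : TA k != 0. Proof. by case: ab_generic => _ _ _ _ /(_ k)[]. Qed.
Let TB0 k : TB k != 0. Proof. by case: ab_generic => _ _ _ _ /(_ k)[]. Qed.
Let TC0 k : TC k != 0. Proof. by case: ab_generic => _ _ _ _ /(_ k)[]. Qed.

Let small_weightE k : small_weight a b q p k =
  TA k * TB k * TC (k - 2) / (TA (k - 1) * TB (k + 2) * TC k) * q.
Proof.
rewrite /small_weight /thetas !big_cons big_nil !mulr1 !mulrA.
have -> : 2 * k - 1 = 2 * (k - 1) + 1 by lia.
by [].
Qed.

Let big_weightE k : big_weight a b q p k =
  TA k * TB 1 * TB 2 * TC (-1) * TC 0 /
  (TA 0 * TB (k + 1) * TB (k + 2) * TC (k - 1) * TC k) * q ^ k.
Proof.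
rewrite /big_weight /thetas !big_cons big_nil !mulr1 !mulrA /TA /TB /TC.
by rewrite (addrC 1) mulr0 add0r expr1z expr0z exprN1 mulr1 -exprnP expr2 mulrA.
Qed.

Let elliptic_numberE z : elliptic_number a b q p z =
  theta (q ^ z) p * theta (a * q ^ z) p * TB 2 * TC 0 /
  (theta q p * TA 0 * TB (z + 1) * TC (z - 1)).
Proof.
rewrite /elliptic_number /thetas !big_cons big_nil !mulr1 !mulrA /TA /TB /TC.
by rewrite mulr0 add0r expr1z expr0z mulr1 -exprnP expr2 mulrA.
Qed.

(** The ratio of [big_weight] at n + 1 and at n is [small_weight] at n + 1. *)
Lemma prod_small_weight n :
  \prod_(t < n) small_weight a b q p (1 + t%:Z) = big_weight a b q p n%:Z.
Proof.
elim: n => [|n IH].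
  rewrite big_ord0 big_weightE add0r sub0r expr0z.
  move: (TA0 0) (TB0 1) (TB0 2) (TC0 (-1)) (TC0 0).
  move: (TA 0) (TB 1) (TB 2) (TC (-1)) (TC 0) => *.
  by field; do !(apply/andP; split).
rewrite big_ord_recr /= IH small_weightE !big_weightE.
have -> : n.+1%:Z = n%:Z + 1 by lia.
have -> : 1 + n%:Z = n%:Z + 1 by lia.
have -> : n%:Z + 1 - 1 = n%:Z by lia.
have -> : n%:Z + 1 - 2 = n%:Z - 1 by lia.
have -> : n%:Z + 1 + 1 = n%:Z + 2 by lia.
rewrite [q ^ (_ + 1)]expfzDr // expr1z.
move: (TA0 0) (TA0 n%:Z) (TB0 (n%:Z + 1)) (TB0 (n%:Z + 2)) (TB0 (n%:Z + 1 + 2)).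
move: (TC0 (n%:Z - 1)) (TC0 n%:Z) (TC0 (n%:Z + 1)).
move: (TA 0) (TA n%:Z) (TA (n%:Z + 1)) (TB (n%:Z + 1)) (TB (n%:Z + 2)) (TB (n%:Z + 1 + 2)).
move: (TC (n%:Z - 1)) (TC n%:Z) (TC (n%:Z + 1)) (TB 1) (TB 2) (TC (-1)) (TC 0) (q ^ n%:Z) => *.
by field; do !(apply/andP; split).
Qed.

Hypothesis p1 : `|p| < 1.

Lemma theta_weierstrass_pow (n : int) :
  theta (a * q ^ (n + 1)) p * theta (q ^ (n + 1)) p * (TB (n + 1) * TC (n - 1)) -
  TB (n + 2) * TC n * (theta (a * q ^ n) p * theta (q ^ n) p) =
  q ^ n * (TB 1 * TC (-1) * (TA n * theta q p)).
Proof.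
(* The symmetric form of the theta addition formula involves x y = a q^(n+1) and
   x / y = q^(n+1), whence the square root of a. *)
pose r := sqrtC a; have rr : a = r * r by rewrite -expr2 sqrtCK.
have r0 : r != 0 by rewrite sqrtC_eq0.
have Q0 : q ^ n != 0 by rewrite expfz_neq0.
(* With u = r q^n, the value v = b q / r makes u v = b q^(n+1) and u / v = a q^(n-1) / b; pairing v
   with x and y gives the other [TB] and [TC] values. *)
have W := @theta_weierstrass _ _ p1 (r * q ^ (n + 1)) r (r * q ^ n) (b * q / r).
rewrite !mulf_neq0 ?invr_eq0 ?expfz_neq0 // in W.
have {}W := W isT r0 isT isT.
rewrite /TA /TB /TC rr.
have -> : 2 * n + 1 = n + n + 1 by lia.
rewrite -exprnN expr1z expr1 ![q ^ (_ + 1)]expfzDr // expr1z.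
rewrite [q ^ (n + 2)]expfzDr // -exprnP [q ^ (n - 1)]expfzDr // -exprnN expr1.
rewrite [q ^ (n + n)]expfzDr //.
rewrite expfzDr // expr1z in W.
move: (q ^ n) Q0 W => Q Q0 W.
have e1 : r * (Q * q) * r = r * r * (Q * q) by ring.
have e2 : r * (Q * q) / r = Q * q by field.
have e3 : r * Q * (b * q / r) = b * (Q * q) by field.
have e4 : r * Q / (b * q / r) = r * r * (Q / q) / b by field; rewrite q0 b0 r0.
have e5 : r * (Q * q) * (b * q / r) = b * (Q * q ^+ 2) by field.
have e6 : r * (Q * q) / (b * q / r) = r * r * Q / b by field; rewrite q0 b0 r0.
have e7 : r * Q * r = r * r * Q by ring.
have e8 : r * Q / r = Q by field.
have e9 : r * (b * q / r) = b * q by field.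
have e10 : r / (b * q / r) = r * r / q / b by field; rewrite q0 b0 r0.
have e11 : r * (Q * q) * (r * Q) = r * r * (Q * Q * q) by ring.
have e12 : r * (Q * q) / (r * Q) = q by field; rewrite r0 Q0.
by rewrite e1 e2 e3 e4 e5 e6 e7 e8 e9 e10 e11 e12 in W.
Qed.

Lemma elliptic_number_succ (n : int) :
  elliptic_number a b q p (n + 1) = elliptic_number a b q p n + big_weight a b q p n.
Proof.
rewrite !elliptic_numberE big_weightE; have := theta_weierstrass_pow n.
have -> : n + 1 + 1 = n + 2 by lia.
have -> : n + 1 - 1 = n by lia.
move: (TA0 0) (TA0 n) (TB0 (n + 1)) (TB0 (n + 2)) (TC0 (n - 1)) (TC0 n) tq0.
move: (TB0 1) (TC0 (-1)).
move: (q ^ n) (theta (a * q ^ (n + 1)) p) (theta (q ^ (n + 1)) p) (theta (a * q ^ n) p)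
  (theta (q ^ n) p) (theta q p) (TA 0) (TA n) (TB (n + 1)) (TB (n + 2))
  (TC (n - 1)) (TC n) (TB 1) (TC (-1)) (TB 2) (TC 0).
move=> Q t1 t2 t3 t4 t5 u1 u2 u3 u4 u5 u6 u7 u8 u9 u10 h1 h2 h3 h4 h5 h6 h7 h8 h9 W.
(* The addition formula is solved for q^n, after which the claim is an identity of rational
   functions. *)
have -> : Q = (t1 * t2 * (u3 * u5) - u4 * u6 * (t3 * t4)) / (u7 * u8 * (u2 * t5)).
  by rewrite W mulfK // !mulf_neq0.
by field; do !(apply/andP; split).
Qed.

(** The increments of the elliptic numbers are the big weights, and [0] = 0 because theta(1) = 0. *)
Lemma sum_big_weight n :
  \sum_(u < n) big_weight a b q p u%:Z = elliptic_number a b q p n%:Z.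
Proof.
elim: n => [|n IH].
  by rewrite big_ord0 elliptic_numberE expr0z theta1 // !mul0r.
rewrite big_ord_recr /= IH -elliptic_number_succ.
by have -> : n%:Z + 1 = n.+1%:Z by lia.
Qed.

End Weights.

(** * Rook placements *)

Lemma gtn_trans : transitive gtn.
Proof. by move=> x y z /= ? ?; lia. Qed.

(** * Products and sums along a decreasing list *)

Section RankSums.
Variable V : comNzRingType.

(** For an entry j of a strictly decreasing list, this is its position, counted from 1. *)
Definition rank_in (s : seq nat) j := count (leq j) s.

Let rank_cons x s j : path gtn x s -> j \in s -> rank_in (x :: s) j = (rank_in s j).+1.
Proof.
rewrite /rank_in /= => /(order_path_min gtn_trans) /allP H /H /=.
by move=> /ltnW ->.
Qed.

Let rank_head x s : path gtn x s -> rank_in (x :: s) x = 1%N.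
Proof.
move=> /(order_path_min gtn_trans) /allP H.
rewrite /rank_in /= leqnn; congr _.+1; apply/eqP; rewrite -leqn0 leqNgt -has_count.
by apply/hasPn => y /H /=; rewrite -ltnNge.
Qed.

Lemma prod_rank (F : nat -> V) s : sorted gtn s ->
  \prod_(j <- s) F (rank_in s j) = \prod_(t < size s) F t.+1.
Proof.
elim: s F => [|x s IH] F xs; first by rewrite big_nil big_ord0.
rewrite big_cons big_ord_recl rank_head //; congr (_ * _).
rewrite -(IH (fun t => F t.+1)) ?(path_sorted xs) //.
by apply: eq_big_seq => j js; rewrite rank_cons.
Qed.

(** The entry of rank u + 1 has exactly the ranks 1, ..., u above it. In the induction the head
    contributes an empty product, and its factor [F 1] is common to all other summands. *)
Lemma sum_prod_rank (F : nat -> V) s : sorted gtn s ->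
  \sum_(j <- s) \prod_(i <- s | (j < i)%N) F (rank_in s i) =
  \sum_(u < size s) \prod_(t < u) F t.+1.
Proof.
elim: s F => [|x s IH] F xs; first by rewrite big_nil big_ord0.
have /allP xmax : all (gtn x) s.
  exact: (order_path_min gtn_trans xs).
rewrite big_cons big_ord_recl big_ord0; congr (_ + _).
  rewrite big_cons ltnn big_seq_cond big_pred0 // => i; apply/negbTE/negP.
  by case/andP => /xmax /= ix xi; lia.
have {}IH := IH (fun t => F t.+1) (path_sorted xs).
transitivity (F 1%N * \sum_(u < size s) \prod_(t < u) F t.+2); last first.
  by rewrite mulr_sumr; apply: eq_bigr => u _; rewrite [RHS]big_ord_recl.
rewrite -IH mulr_sumr; apply: eq_big_seq => j js.
have jx : (j < x)%N by exact: xmax.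
rewrite big_cons jx rank_head //; congr (_ * _).
rewrite big_seq_cond [RHS]big_seq_cond; apply: eq_bigr => i /andP[si _].
by rewrite rank_cons.
Qed.

End RankSums.

Section Placements.
Local Open Scope fset_scope.
Local Open Scope ring_scope.
Implicit Types (h : seq nat) (P B : {fset nat * nat}) (c r : nat * nat).

Lemma mem_board h c : (c \in board h) =
  (0 < c.1 <= size h)%N && (0 < c.2 <= nth 0%N h c.1.-1)%N.
Proof.
case: c => i j; apply/imfset2P/idP => /=.
  by move=> [i' + [j' + [-> ->]]]; rewrite /= !mem_iota !add1n !ltnS => -> ->.
move=> /andP[hi hj]; exists i; first by rewrite /= mem_iota add1n ltnS.
by exists j => //; rewrite /= mem_iota add1n ltnS.
Qed.

Lemma mem_board_rcons h m c : (c \in board (rcons h m)) =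
  (c \in board h) || (c.1 == (size h).+1) && (0 < c.2 <= m)%N.
Proof.
case: c => i j; rewrite !mem_board size_rcons nth_rcons /=.
case: i => [|i] //=; rewrite ltnS eqSS leq_eqVlt.
by case: ltngtP => //= _; rewrite ?orbF.
Qed.

Lemma nonattackingP P : reflect
  (forall c d, c \in P -> d \in P -> c != d -> c.1 != d.1 /\ c.2 != d.2)
  (nonattacking P).
Proof.
apply: (iffP forallP) => [H c d cP dP cd|H c].
  by have /forallP/(_ [` dP])/implyP/(_ cd)/andP := H [` cP].
by apply/forallP => d; apply/implyP => cd; apply/andP; apply: H; rewrite ?fsvalP.
Qed.

Lemma placementsP k B P : reflect
  [/\ {subset P <= B}, nonattacking P & #|` P|%:Z = k] (P \in placements k B).
Proof.
rewrite !inE fpowersetE; apply: (iffP and3P) => -[].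
  by move=> /fsubsetP ? ? /eqP.
by move=> ? ? /eqP ?; split=> //; apply/fsubsetP.
Qed.

Lemma mem_uncancelled B P c : (c \in uncancelled B P) =
  [&& c \in B, c \notin P & ~~ has (cancels^~ c) P].
Proof.
rewrite !inE; congr [&& _, _ & ~~ _]; apply/existsP/hasP.
  by move=> [r rc]; exists (val r) => //; exact: fsvalP.
by move=> [r rP rc]; exists [` rP].
Qed.

Definition rook_rows P : seq nat := [seq r.2 | r <- enum_fset P].

(** The rows left open in a new last column of height m, listed from the top because the weights are
    read in that order. *)
Definition free_rows m P : seq nat := [seq j <- rev (iota 1 m) | j \notin rook_rows P].

Lemma mem_free_rows m P j :
  (j \in free_rows m P) = (j \notin rook_rows P) && (0 < j <= m)%N.
Proof. by rewrite mem_filter mem_rev mem_iota add1n ltnS. Qed.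

Lemma free_rows_sorted m P : sorted gtn (free_rows m P).
Proof.
apply: sorted_filter; first exact: gtn_trans.
by rewrite rev_sorted iota_ltn_sorted.
Qed.

Lemma rook_rows_uniq P : nonattacking P -> uniq (rook_rows P).
Proof.
move=> /nonattackingP H; rewrite map_inj_in_uniq ?fset_uniq // => c d cP dP e.
by apply/eqP/negP => /negP /(H _ _ cP dP)[_]; rewrite e eqxx.
Qed.

(** Nonattacking rooks stand in distinct columns. *)
Lemma placement_card_le_size k h P : P \in placements k (board h) ->
  (#|` P| <= size h)%N.
Proof.
move=> /placementsP[PB /nonattackingP H _].
have u : uniq [seq r.1 | r <- enum_fset P].
  rewrite map_inj_in_uniq ?fset_uniq // => c d cP dP e.
  by apply/eqP/negP => /negP /(H _ _ cP dP)[]; rewrite e eqxx.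
have -> : #|` P| = size [seq r.1 | r <- enum_fset P] by rewrite size_map.
rewrite -[leqRHS](size_iota 1); apply: uniq_leq_size => // _ /mapP[r rP ->].
by rewrite mem_iota add1n ltnS; have := PB _ rP; rewrite mem_board => /andP[].
Qed.

(** * Placements and uncancelled cells after adding a column *)

Section LastColumn.
Variables (h : seq nat) (m : nat).
Hypothesis hm : all (fun c : nat => (c <= m)%N) h.
Let B := board h.
Let B' := board (rcons h m).
Let l1 := (size h).+1.

Let board_bounds c : c \in B -> (c.1 < l1)%N /\ (0 < c.2 <= m)%N.
Proof.
rewrite mem_board => /andP[ci /andP[-> cj]]; split; first by rewrite ltnS; case/andP: ci.
case/andP: ci => c0 c1; apply: leq_trans cj _; apply: (allP hm).
by apply: mem_nth; rewrite prednK.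
Qed.

Lemma perm_rook_rows P : {subset P <= B} -> nonattacking P ->
  perm_eq (free_rows m P ++ rook_rows P) (iota 1 m).
Proof.
move=> PB nP; apply: uniq_perm; last 1 first.
- move=> j; rewrite mem_cat mem_free_rows mem_iota add1n ltnS.
  case: (boolP (j \in rook_rows P)) => //= [/mapP[r /PB /board_bounds[_ H] ->]|_].
    by rewrite H.
  by rewrite orbF.
- rewrite cat_uniq rook_rows_uniq // andbT filter_uniq ?rev_uniq ?iota_uniq //=.
  by apply/hasPn => j jP; rewrite mem_free_rows jP.
- exact: iota_uniq.
Qed.

Lemma size_free_rows P : {subset P <= B} -> nonattacking P ->
  (size (free_rows m P) + #|` P| = m)%N.
Proof.
move=> PB nP; have /perm_size := perm_rook_rows PB nP.
by rewrite size_cat size_map size_iota.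
Qed.

(** The m + 1 - j rows from j up to m are either free, counted by the rank, or hold a rook of P,
    counted by [rooks_nw]. *)
Lemma rank_free_rows P j : {subset P <= B} -> nonattacking P -> j \in free_rows m P ->
  (rank_in (free_rows m P) j + rooks_nw P (l1, j) + j = m.+1)%N.
Proof.
move=> PB nP jf; have := jf; rewrite mem_free_rows => /andP[jr jm].
have /permP/(_ (leq j)) := perm_rook_rows PB nP; rewrite count_cat -/(rank_in _ _).
(* As row j holds no rook, weakly above j means strictly above for rooks. *)
have -> : count (leq j) (rook_rows P) = rooks_nw P (l1, j).
  rewrite /rooks_nw count_map -size_filter.
  rewrite -[LHS](@perm_size _ (enum_fset [fset r in P | (r.1 < l1)%N && (j < r.2)%N])) //.
  apply: uniq_perm; rewrite ?fset_uniq ?filter_uniq //.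
  move=> r; rewrite mem_filter !inE; case: (boolP (r \in P)) => rP; rewrite ?andbF ?andbT //=.
  have [-> _] := board_bounds (PB _ rP); rewrite /= [RHS]leq_eqVlt.
  suff /negbTE -> : j != r.2 by [].
  by apply: contra jr => /eqP ->; exact: map_f.
have -> : count (leq j) (iota 1 m) = (m.+1 - j)%N.
  have -> : iota 1 m = iota 1 j.-1 ++ iota j (m.+1 - j).
    have {2}-> : j = (1 + j.-1)%N by lia.
    by rewrite -iotaD; congr iota; lia.
  rewrite count_cat.
  have /eqP -> : count (leq j) (iota 1 j.-1) == 0%N.
    by rewrite -leqn0 leqNgt -has_count; apply/hasPn => i; rewrite mem_iota /=; lia.
  rewrite add0n -[RHS](size_iota j); apply/eqP; rewrite -all_count; apply/allP => i.
  by rewrite mem_iota => /andP[].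
by lia.
Qed.

(** All rooks lie left of the last column, so they cancel there exactly the cells in their own
    rows. *)
Lemma perm_uncancelled P : {subset P <= B} ->
  perm_eq (uncancelled B' P) (uncancelled B P ++ [seq (l1, j) | j <- free_rows m P]).
Proof.
move=> PB; apply: uniq_perm; first exact: fset_uniq.
- rewrite cat_uniq fset_uniq /= map_inj_uniq; last by move=> ? ? [].
  rewrite filter_uniq ?rev_uniq ?iota_uniq // andbT; apply/hasPn => _ /mapP[j _ ->].
  apply/negP; rewrite mem_uncancelled => /and3P[/board_bounds[]]; rewrite /= ltnn //.
move=> [i j]; rewrite mem_cat !mem_uncancelled mem_board_rcons -/B.
case: (boolP ((i, j) \in B)) => [cB|cB] /=.
  have [ci _] := board_bounds cB.
  suff -> : ((i, j) \in [seq (l1, j) | j <- free_rows m P]) = false by rewrite orbF.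
  by apply/negP => /mapP[j' _ [e _]]; move: ci; rewrite e ltnn.
rewrite -/l1; case: eqP => [->|ne] /=; last first.
  by apply/esym/negP => /mapP[j' _ [e _]].
rewrite mem_map; last by move=> ? ? [].
rewrite mem_free_rows andbC.
have -> : (l1, j) \notin P by apply/negP => /PB /board_bounds[]; rewrite ltnn.
congr (~~ _ && _); apply/hasP/mapP => -[r rP].
  have [r1 _] := board_bounds (PB _ rP).
  by rewrite /cancels /= (ltn_eqF r1) orbF => /andP[/eqP <- _]; exists r.
move=> ->; exists r => //; have [r1 _] := board_bounds (PB _ rP).
by rewrite /cancels /= eqxx r1.
Qed.

(** The extra rook cancels the cells below it in the last column and none in B, so that column keeps
    its free cells above row [j0]. *)
Lemma perm_uncancelledU1 P j0 : {subset P <= B} -> j0 \in free_rows m P ->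
  perm_eq (uncancelled B' ((l1, j0) |` P))
    (uncancelled B P ++ [seq (l1, j) | j <- free_rows m P & (j0 < j)%N]).
Proof.
move=> PB j0f; apply: uniq_perm; first exact: fset_uniq.
- rewrite cat_uniq fset_uniq /= map_inj_uniq; last by move=> ? ? [].
  rewrite !filter_uniq ?rev_uniq ?iota_uniq // andbT; apply/hasPn => _ /mapP[j _ ->].
  apply/negP; rewrite mem_uncancelled => /and3P[/board_bounds[]]; rewrite /= ltnn //.
move=> [i j]; rewrite mem_cat !mem_uncancelled mem_board_rcons -/B.
have hasU (c : nat * nat) : has (cancels^~ c) ((l1, j0) |` P) =
    cancels (l1, j0) c || has (cancels^~ c) P.
  apply/hasP/orP => [[r]|[]].
  - by rewrite !inE => /orP[/eqP ->|rP] rc; [left | right; apply/hasP; exists r].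
  - by exists (l1, j0) => //; rewrite !inE eqxx.
  - by move=> /hasP[r rP rc]; exists r => //; rewrite !inE rP orbT.
rewrite hasU !inE.
case: (boolP ((i, j) \in B)) => [cB|cB] /=.
  have [ci _] := board_bounds cB; rewrite /= in ci.
  have -> : ((i, j) \in [seq (l1, j) | j <- free_rows m P & (j0 < j)%N]) = false.
    by apply/negP => /mapP[j' _ [e _]]; move: ci; rewrite e ltnn.
  rewrite orbF xpair_eqE (ltn_eqF ci) /= /cancels /= [l1 == i]eq_sym (ltn_eqF ci).
  by rewrite orbF ltnNge (ltnW ci) andbF.
rewrite -/l1; case: eqP => [->|ne] /=; last first.
  by apply/esym/negP => /mapP[j' _ [e _]].
rewrite mem_map; last by move=> ? ? [].
rewrite mem_filter mem_free_rows xpair_eqE eqxx /=.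
have -> : ((l1, j) \in P) = false by apply/negP => /PB /board_bounds[]; rewrite ltnn.
have -> : has (cancels^~ (l1, j)) P = (j \in rook_rows P).
  apply/hasP/mapP => -[r rP].
    have [r1 _] := board_bounds (PB _ rP).
    by rewrite /cancels /= (ltn_eqF r1) orbF => /andP[/eqP <- _]; exists r.
  move=> ->; exists r => //; have [r1 _] := board_bounds (PB _ rP).
  by rewrite /cancels /= eqxx r1.
rewrite /cancels /= ltnn andbF eqxx orbF /=.
by case: (ltngtP j0 j) => _; case: (j \in _); rewrite /= ?andbF ?andbT.
Qed.

Lemma rooks_nwU1 P j0 c : (c.1 <= l1)%N -> rooks_nw ((l1, j0) |` P) c = rooks_nw P c.
Proof.
move=> cl; rewrite /rooks_nw; congr #|` _|; apply/fsetP => r; rewrite !inE.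
case: eqP => [->|] //=; rewrite ltnNge cl /= andbF //.
Qed.

(** The last column holds at most one rook, and removing it inverts the insertion of a rook into a
    free row. *)
Lemma placements_rcons k : perm_eq (placements k B')
  (placements k B ++
   [seq (l1, j) |` P | P <- placements (k - 1) B, j <- free_rows m P]).
Proof.
have notin j P : {subset P <= B} -> (l1, j) \notin P.
  by move=> PB; apply/negP => /PB /board_bounds[]; rewrite ltnn.
apply: uniq_perm; first exact: fset_uniq.
- rewrite cat_uniq fset_uniq /=; apply/andP; split.
    apply/hasPn => _ /allpairsPdep[P [j [_ _ ->]]].
    apply/negP => /placementsP[/(_ (l1, j))]; rewrite !inE eqxx => /(_ isT).
    by move=> /board_bounds[]; rewrite ltnn.
  apply: allpairs_uniq_dep; first exact: fset_uniq.
    by move=> P _; rewrite filter_uniq // rev_uniq iota_uniq.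
  move=> x y /allpairsPdep[P [j [/placementsP[PB _ _] _ ->]]].
  move=> /allpairsPdep[Q [i [/placementsP[QB _ _] _ ->]]] /= e.
  have : (l1, j) \in (l1, i) |` Q by rewrite -e !inE eqxx.
  rewrite !inE (negbTE (notin _ _ QB)) orbF => /eqP[ji]; subst j.
  by rewrite -(fsetU1K (notin i P PB)) e fsetU1K // notin.
move=> P'; rewrite mem_cat; apply/placementsP/orP => [[PB' nP' sz]|[]].
- have /nonattackingP attack := nP'.
  have [/hasP[[i j] rP /eqP /= ri]|/hasPn nr] := boolP (has (fun c => c.1 == l1) P').
    subst i; right; apply/allpairsPdep; exists (P' `\ (l1, j)), j.
    have PB : {subset P' `\ (l1, j) <= B}.
      move=> c; rewrite !inE => /andP[cr cP].
      have := PB' _ cP; rewrite mem_board_rcons => /orP[//|/andP[/eqP cl _]].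
      by have [] := attack _ _ cP rP cr; rewrite cl eqxx.
    split; last by rewrite fsetD1K.
      apply/placementsP; split=> //.
        by apply/nonattackingP => c d; rewrite !inE => /andP[_ cP] /andP[_ dP]; exact: attack.
      by move: sz; rewrite (cardfsD1 (l1, j)) rP => <-; lia.
    rewrite mem_free_rows; apply/andP; split.
      apply/negP => /mapP[c]; rewrite !inE => /andP[cr cP] jc.
      by have [_] := attack _ _ cP rP cr; rewrite /= -jc eqxx.
    have := PB' _ rP; rewrite mem_board_rcons => /orP[/board_bounds[_]//|].
    by case/andP.
  left; apply/placementsP; split=> // c cP; have := PB' _ cP.
  by rewrite mem_board_rcons => /orP[//|/andP[cl _]]; have := nr _ cP; rewrite cl.
- move=> /placementsP[PB nP sz]; split=> // c cP.
  by rewrite mem_board_rcons PB.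
- move=> /allpairsPdep[P [j [/placementsP[PB nP sz] jf ->]]]; split; last first.
  + by rewrite cardfsU1 notin // PoszD sz; lia.
  + apply/nonattackingP => c d; move: jf; rewrite mem_free_rows => /andP[jr _].
    have apart e : e \in P -> l1 != e.1 /\ j != e.2.
      move=> eP; split; first by have [el _] := board_bounds (PB _ eP); rewrite gtn_eqF.
      by apply: contra jr => /eqP ->; exact: map_f.
    rewrite !inE => /orP[/eqP ->|cP] /orP[/eqP ->|dP].
    * by rewrite eqxx.
    * by move=> _; exact: apart.
    * by move=> _; have [] := apart _ cP; rewrite eq_sym => -> ; rewrite eq_sym.
    * by move/nonattackingP: nP => H; exact: H.
  + move=> c; rewrite mem_board_rcons !inE => /orP[/eqP ->|/PB -> //].
    by move: jf; rewrite mem_free_rows => /andP[_ jm]; rewrite eqxx jm orbT.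
Qed.

End LastColumn.
End Placements.

(** * The recursion for elliptic rook numbers *)

Section RookRecursion.
Local Open Scope fset_scope.
Local Open Scope ring_scope.
Variables (R : realType) (a b q p : R[i]) (h : seq nat) (m : nat).
Hypothesis hgen : generic a b q p.
Hypothesis p1 : `|p| < 1.
Hypothesis hm : all (fun c : nat => (c <= m)%N) h.
Let l := size h.
Let s := l%:Z - m%:Z.
Let a' := a * q ^ (2 * s).
Let b' := b * q ^ s.

Let weight (P : {fset nat * nat}) (c : nat * nat) : R[i] :=
  small_weight a b q p (c.1%:Z - c.2%:Z - (rooks_nw P c)%:Z).

Let F (t : nat) := small_weight a' b' q p t%:Z.

Let generic' : generic a' b' q p. Proof. exact: shift_generic. Qed.

(** By [rank_free_rows] the argument l + 1 - j - r equals s plus the rank of j; the shift s is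
    absorbed in the parameters. *)
Lemma last_column_weight P j : {subset P <= board h} -> nonattacking P ->
  j \in free_rows m P -> weight P (l.+1, j) = F (rank_in (free_rows m P) j).
Proof.
move=> PB nP jf; have := rank_free_rows hm PB nP jf.
have [_ b0 q0 _ _] := hgen; rewrite /F small_weight_shift // /weight /s /l /= => e.
by congr small_weight; lia.
Qed.

Lemma prod_last_column k P : P \in placements k (board h) ->
  \prod_(c <- uncancelled (board (rcons h m)) P) weight P c =
  big_weight a' b' q p (m%:Z - k) * \prod_(c <- uncancelled (board h) P) weight P c.
Proof.
move=> /placementsP[PB nP sz].
rewrite (perm_big _ (perm_uncancelled hm PB)) big_cat /= big_map mulrC; congr (_ * _).
have -> : m%:Z - k = (size (free_rows m P))%:Z.
  by have := size_free_rows hm PB nP; lia.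
rewrite -(prod_small_weight generic') -(prod_rank F (free_rows_sorted m P)).
by apply: eq_big_seq => j; exact: last_column_weight.
Qed.

(** There are m - k + 1 free rows. A rook in the (u + 1)-st of them from the top leaves u cells of
    total weight W(u), and these sum to the elliptic number. *)
Lemma sum_last_column k P : P \in placements (k - 1) (board h) ->
  \sum_(j <- free_rows m P)
    \prod_(c <- uncancelled (board (rcons h m)) ((l.+1, j) |` P))
      weight ((l.+1, j) |` P) c =
  elliptic_number a' b' q p (m%:Z - k + 1) *
  \prod_(c <- uncancelled (board h) P) weight P c.
Proof.
move=> /placementsP[PB nP sz].
have -> : m%:Z - k + 1 = (size (free_rows m P))%:Z.
  by have := size_free_rows hm PB nP; lia.
rewrite -(sum_big_weight generic' p1).
have -> : \sum_(u < size (free_rows m P)) big_weight a' b' q p u%:Z =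
    \sum_(u < size (free_rows m P)) \prod_(t < u) F t.+1.
  by apply: eq_bigr => u _; rewrite -(prod_small_weight generic').
rewrite -(sum_prod_rank F (free_rows_sorted m P)) mulr_suml.
apply: eq_big_seq => j jf.
rewrite (perm_big _ (perm_uncancelledU1 hm PB jf)) big_cat /= big_map big_filter mulrC.
congr (_ * _).
  rewrite big_seq_cond [RHS]big_seq_cond; apply: eq_bigr => i /andP[iF _].
  by rewrite -last_column_weight // /weight rooks_nwU1.
apply: eq_big_seq => c; rewrite mem_uncancelled => /andP[cB _].
rewrite /weight rooks_nwU1 //; move: cB; rewrite mem_board => /andP[/andP[_ cl] _].
exact: leqW.
Qed.

Lemma rook_number_rcons k :
  rook_number k a b q p (board (rcons h m)) =
    big_weight a' b' q p (m%:Z - k) * rook_number k a b q p (board h) +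
    elliptic_number a' b' q p (m%:Z - k + 1) * rook_number (k - 1) a b q p (board h).
Proof.
rewrite /rook_number (perm_big _ (placements_rcons hm k)) big_cat /=; congr (_ + _).
  by rewrite mulr_sumr; apply: eq_big_seq => P; exact: prod_last_column.
rewrite big_allpairs_dep mulr_sumr; apply: eq_big_seq => P; exact: sum_last_column.
Qed.

End RookRecursion.

(** * Boundary values and the final statement *)

Lemma rook_number_out_of_range (R : realType) (a b q p : R[i]) h (k : int) :
  k < 0 \/ (size h)%:Z < k -> rook_number k a b q p (board h) = 0.
Proof.
move=> hk; rewrite /rook_number big_seq big_pred0 // => P; apply/negP => Pk.
have := placement_card_le_size Pk; have /placementsP[_ _] := Pk; lia.
Qed.

Lemma rook_number_empty (R : realType) (a b q p : R[i]) :
  rook_number 0 a b q p (board [::]) = 1.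
Proof.
have B0 c : c \notin board [::] by rewrite mem_board /= leqn0; case: (c.1).
rewrite /rook_number (@perm_big _ _ _ _ _ [:: fset0]) /=.
  rewrite big_seq1 big_seq big_pred0 // => c.
  by rewrite mem_uncancelled (negbTE (B0 c)).
apply: uniq_perm; rewrite ?fset_uniq // => P; rewrite mem_seq1.
apply/idP/eqP => [/placementsP[_ _ P0]|->].
  by apply: cardfs0_eq; lia.
by apply/placementsP; split=> //; apply/nonattackingP.
Qed.

Theorem theorem3p10 (R : realType) (a b q p : R[i])
    (hp : `|p| < 1) (hgen : generic a b q p)
    (l m : nat) (h : seq nat) (hl : size h = l)
    (hB : sorted leq h) (hm : all (fun c : nat => (c <= m)%N) h) :
  let s := l%:Z - m%:Z in
  [/\ forall k : int, k < 0 \/ l%:Z < k -> rook_number k a b q p (board h) = 0,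
      l = 0%N -> rook_number 0 a b q p (board h) = 1 &
      forall k : int,
        rook_number k a b q p (board (rcons h m)) =
          big_weight (a * q ^ (2 * s)) (b * q ^ s) q p (m%:Z - k)
            * rook_number k a b q p (board h)
          + elliptic_number (a * q ^ (2 * s)) (b * q ^ s) q p (m%:Z - k + 1)
            * rook_number (k - 1) a b q p (board h)].
Proof.
subst l; move=> s; split.
- exact: rook_number_out_of_range.
- by move/size0nil ->; exact: rook_number_empty.
- exact: rook_number_rcons.
Qed.
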